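(* Let $d$ be a positive integer and let $R_\ell\in\mathbb{R}_{+}\cup\{\infty\}$ be such that $R_\ell\geq 1$ for every $\ell=1,\dots,d$. Let $G_1,\dots,G_d$ be holomorphic functions whose series expansions at zero are given by $$G_\ell(\lambda)=\sum_{m=0}^\infty g_{\ell,m}\lambda^{m},\qquad \ell=1,\dots,d,$$ where the sequences $(g_{\ell,m})_{m\ge 0}$ satisfy $$\limsup_{m\to\infty}|g_{\ell,m}|^{1/m}=\frac{1}{R_\ell},\qquad \ell=1,\dots,d.$$ Set $R:=\min_{\ell=1,\dots,d}R_\ell$. Let $$f_n(x)=\sum_{j=0}^n Z_j(n,a)e^{ih_j(n)x},\qquad n\in\mathbb{N},\ x\in\mathbb{R},$$ with $a\in\mathbb{R}$, be a superoscillating sequence (in one variable), and assume that the entire extensions $f_n(\xi)$, $\xi\in\mathbb{C}$, converge to $e^{ia\xi}$ in $A_{1,B}$ for some real $B$ with $0<B<\frac{R}{4e}$. Define $$F_n(x_1,\dots,x_d):=\sum_{j=0}^n Z_j(n,a)e^{ix_1G_1(h_j(n))}e^{ix_2G_2(h_j(n))}\cdots e^{ix_dG_d(h_j(n))}.$$ Then, whenever $|a|<R$, we have $$\lim_{n\to\infty}F_n(x_1,x_2,\dots,x_d)=e^{ix_1G_1(a)}e^{ix_2G_2(a)}\cdots e^{ix_dG_d(a)}$$ uniformly on compact subsets of $\mathbb{R}^d$. In particular, $F_n(x_1,x_2,\dots,x_d)$ is superoscillating when $|a|>1$.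
   Context: Conventions: $\mathbb{R}_+$ is the set of positive reals, $1/\infty=0$, and $R/(4e)=\infty$ if $R=\infty$. Function spaces: for $B>0$, $A_{1,B}$ is the Banach space of entire functions $f:\mathbb{C}\to\mathbb{C}$ with $\|f\|_B:=\sup_{\xi\in\mathbb{C}}|f(\xi)|e^{-B|\xi|}<+\infty$, with norm $\|\cdot\|_B$. ''$f_n$ converges to $f$ in $A_{1,B}$'' means that $f_n,f\in A_{1,B}$ and $\|f_n-f\|_B\to 0$. Superoscillating sequence in one variable: a generalized Fourier sequence is a sequence $f_n(x)=\sum_{j=0}^n Z_j(n,a)e^{ih_j(n)x}$, $n\in\mathbb{N}$, $x\in\mathbb{R}$, where $a\in\mathbb{R}$, and $Z_j(n,a)$ and $h_j(n)$ are complex valued and real valued functions of the variables $n,a$ and $n$, respectively. It is superoscillating if $\sup_{j,n}|h_j(n)|\le 1$ and there exists a compact subset of $\mathbb{R}$ (a superoscillation set) on which $f_n(x)$ converges uniformly to $e^{ig(a)x}$, where $g$ is a continuous real valued function such that $|g(a)|>1$. Superoscillating sequence in several variables ($d\ge 2$): a generalized Fourier sequence in several variables is a sequence $F_n(x_1,\dots,x_d)=\sum_{j=0}^n c_j(n)e^{ix_1h_{j,1}(n)}\cdots e^{ix_dh_{j,d}(n)}$, $(x_1,\dots,x_d)\in\mathbb{R}^d$, with complex-valued $c_j(n)$ and real-valued $h_{j,\ell}(n)$, $j=0,\dots,n$, $n\in\mathbb{N}_0$. It is superoscillating if $\sup_{j=0,\dots,n,\ n\in\mathbb{N}_0}|h_{j,\ell}(n)|\le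 1$ for $\ell=1,\dots,d$ and there exists a compact subset of $\mathbb{R}^d$ (a superoscillation set) on which $F_n$ converges uniformly to $e^{ix_1g_1}\cdots e^{ix_dg_d}$, where $|g_\ell|>1$ for $\ell=1,\dots,d$.
   Formalization: The claim that F_n is superoscillating when |a|>1 is stated under the added assumption that all G_l(h_j(n)) are real of modulus at most 1 and all G_l(a) are real of modulus greater than 1; without it the claim fails, e.g. for d=1, G_1(λ)=2λ. *)

(* Defs.v *)
From HB Require Import structures.
From mathcomp Require Export all_boot all_order all_algebra.
From mathcomp Require Export complex.
From mathcomp Require Export all_classical all_reals all_analysis.

Export Order.TTheory GRing.Theory Num.Theory.
Export numFieldNormedType.Exports.

#[export] Set Implicit Arguments.
#[export] Unset Strict Implicit.
#[export] Unset Printing Implicit Defensive.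

Global Open Scope classical_set_scope.
Global Open Scope complex_scope.
Global Open Scope ring_scope.

(* The bare type [R[i]] carries no topology; viewed as a [numClosedFieldType]
   it inherits the topology and the normed structure of a numeric field. *)
Definition cplx (R : realType) : numClosedFieldType := R[i].

(* The real-valued modulus; the norm [`|z|] takes its values in [cplx R]. *)
Definition cabs (R : realType) (z : cplx R) : R := complex.Re `|z|.

Definition ofR (R : realType) (x : R) : cplx R := x%:C.

Definition cexp (R : realType) (z : cplx R) : cplx R :=
  (expR (complex.Re z) * cos (complex.Im z))
    +i* (expR (complex.Re z) * sin (complex.Im z)).

Definition holomorphic_at (R : realType) (f : cplx R -> cplx R) (z : cplx R) :
  Prop := derivable (f : (cplx R)^o -> (cplx R)^o) z 1.

Definition entire (R : realType) (f : cplx R -> cplx R) : Prop :=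
  forall z, holomorphic_at f z.

Definition normA1 (R : realType) (B : R) (f : cplx R -> cplx R) : \bar R :=
  ereal_sup [set (cabs (f z) * expR (- (B * cabs z)))%:E | z in [set: cplx R]].

Definition inA1 (R : realType) (B : R) (f : cplx R -> cplx R) : Prop :=
  entire f /\ (normA1 B f < +oo)%E.

Definition cvgA1 (R : realType) (B : R) (f : nat -> cplx R -> cplx R)
    (f0 : cplx R -> cplx R) : Prop :=
  [/\ forall n, inA1 B (f n), inA1 B f0 &
      (fun n => normA1 B (fun z => f n z - f0 z)) @ \oo --> (0 : \bar R)].

(* Below, [Z n j a], [h n j], [c n j], [h n j l] stand for $Z_j(n,a)$,
   $h_j(n)$, $c_j(n)$, $h_{j,l}(n)$; only the values with [j <= n] matter. *)

(* The entire extension of a one-variable generalized Fourier sequence. *)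
Definition gfs1 (R : realType) (Z : nat -> nat -> R -> cplx R)
    (h : nat -> nat -> R) (a : R) (n : nat) (xi : cplx R) : cplx R :=
  \sum_(j < n.+1) Z n j a * cexp ('i * ofR (h n j) * xi).

Definition superoscillating1 (R : realType) (Z : nat -> nat -> R -> cplx R)
    (h : nat -> nat -> R) (a : R) : Prop :=
  (forall n j, (j <= n)%N -> `|h n j| <= 1) /\
  exists (K : set R) (g : R -> R),
    [/\ compact K, continuous g, 1 < `|g a| &
        {uniform K, (fun n (x : R) => gfs1 Z h a n (ofR x)) @ \oo -->
                    (fun x : R => cexp ('i * ofR (g a * x)))}].

Definition gfs (R : realType) (d : nat) (c : nat -> nat -> cplx R)
    (h : nat -> nat -> 'I_d -> R) (n : nat) (x : 'rV[R]_d) : cplx R :=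
  \sum_(j < n.+1) c n j * \prod_(l < d) cexp ('i * ofR (x ord0 l * h n j l)).

Definition superoscillation_set (R : realType) (d : nat)
    (c : nat -> nat -> cplx R) (h : nat -> nat -> 'I_d -> R)
    (g : 'I_d -> R) (K : set 'rV[R]_d) : Prop :=
  [/\ compact K, forall l, 1 < `|g l| &
      {uniform K, (gfs c h) @ \oo -->
        (fun x : 'rV[R]_d => \prod_(l < d) cexp ('i * ofR (x ord0 l * g l)))}].

Definition superoscillating (R : realType) (d : nat)
    (c : nat -> nat -> cplx R) (h : nat -> nat -> 'I_d -> R) : Prop :=
  (forall n j l, (j <= n)%N -> `|h n j l| <= 1) /\
  exists g K, superoscillation_set c h g K.

(* Main.v *)
(** Let q = eB < R.  If D(xi) = sum_i c_i exp(w_i xi) satisfies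
    |D(xi)| <= eps exp(B|xi|), then Cauchy's estimate on the circle |xi| = m/B
    gives |sum_i c_i w_i^m| <= eps q^m for every m.  Apply this to
    D = f_n - exp(i a .), whose frequencies are the h_j(n), with weights
    Z_j(n,a), and a, with weight -1.  The moment bound has two consequences.
    First, the total weight carried by each frequency outside the disc
    |w| <= q vanishes, so values of the G_l beyond their discs of convergence
    are irrelevant.  Secondly, if S is a power series whose absolute series at
    q is at most A, then |sum_i c_i exp(S(w_i))| <= eps exp(A).  With
    S = i sum_l x_l G_l the left-hand side is the difference between F_n and
    its claimed limit, and A is bounded for x in a compact set.

    Exponentials are approximated by (1 + z/n)^n, so that only polynomials
    occur; their coefficients on a circle are extracted by averaging over
    roots of unity. *)

Require Import Defs.
From HB Require Import structures.
From mathcomp Require Import ring lra.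
From mathcomp Require Import cyclic separable cyclotomic.

Section Modulus.
Variable R : realType.
Implicit Types (z w : cplx R) (x y : R).

Lemma ofRE x : ofR x = x +i* 0. Proof. by []. Qed.

HB.instance Definition _ := GRing.RMorphism.copy (@ofR R) (real_complex R).

Lemma cabs_norm z : `|z| = ofR (cabs z).
Proof. by rewrite /cabs (normc_def z). Qed.

Lemma ofR_inj : injective (@ofR R).
Proof. exact: complexI. Qed.

Lemma ler_ofR x y : (ofR x <= ofR y) = (x <= y).
Proof. exact: lecR. Qed.

Lemma cabs_ge0 z : 0 <= cabs z.
Proof. by rewrite /cabs (normc_def z) /= sqrtr_ge0. Qed.

Lemma cabsM z w : cabs (z * w) = cabs z * cabs w.
Proof. by apply: ofR_inj; rewrite rmorphM -!cabs_norm normrM. Qed.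

Lemma cabs0 : cabs (0 : cplx R) = 0.
Proof. by apply: ofR_inj; rewrite -cabs_norm normr0. Qed.

Lemma cabs1 : cabs (1 : cplx R) = 1.
Proof. by apply: ofR_inj; rewrite -cabs_norm normr1. Qed.

Lemma cabsX z n : cabs (z ^+ n) = cabs z ^+ n.
Proof. by apply: ofR_inj; rewrite rmorphXn -!cabs_norm normrX. Qed.

Lemma cabsN z : cabs (- z) = cabs z.
Proof. by apply: ofR_inj; rewrite -!cabs_norm normrN. Qed.

Lemma cabsB z w : cabs (z - w) = cabs (w - z).
Proof. by rewrite -cabsN opprB. Qed.

Lemma cabsi : cabs ('i : cplx R) = 1.
Proof. by apply: ofR_inj; rewrite -cabs_norm normCi. Qed.

Lemma cabs_ofR x : cabs (ofR x) = `|x|.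
Proof. by rewrite /cabs (normc_def (ofR x)) /= expr0n addr0 sqrtr_sqr. Qed.

Lemma cabs_eq0 z : (cabs z == 0) = (z == 0).
Proof. by rewrite -(inj_eq ofR_inj) -cabs_norm normr_eq0. Qed.

Lemma cabsD z w : cabs (z + w) <= cabs z + cabs w.
Proof. by rewrite -ler_ofR rmorphD -!cabs_norm ler_normD. Qed.

Lemma cabs_sum I (s : seq I) (P : pred I) (F : I -> cplx R) :
  cabs (\sum_(i <- s | P i) F i) <= \sum_(i <- s | P i) cabs (F i).
Proof.
elim/big_ind2 : _ => [|x1 x2 y1 y2 h1 h2|//]; first by rewrite cabs0.
exact: le_trans (cabsD _ _) (lerD h1 h2).
Qed.

Lemma cabsV z : cabs z^-1 = (cabs z)^-1.
Proof. by apply: ofR_inj; rewrite fmorphV -!cabs_norm normfV. Qed.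

Lemma Re_le_cabs z : `|complex.Re z| <= cabs z.
Proof. by rewrite -ler_ofR -cabs_norm; exact: normc_ge_Re. Qed.

Lemma Im_le_cabs z : `|complex.Im z| <= cabs z.
Proof.
rewrite /cabs (normc_def z) /= -sqrtr_sqr ler_wsqrtr// lerDr sqr_ge0//.
Qed.

Lemma cabs_le_ReIm z : cabs z <= `|complex.Re z| + `|complex.Im z|.
Proof.
case: z => x y; have e : x +i* y = ofR x + 'i * ofR y :> cplx R.
  by rewrite -[('i : cplx R)]complexiE !ofRE; simpc.
rewrite [X in cabs X]e (le_trans (cabsD _ _))//.
by rewrite cabsM cabsi mul1r !cabs_ofR.
Qed.

Lemma cexpD z w : cexp (z + w) = cexp z * cexp w.
Proof.
case: z w => x y [x' y']; rewrite /cexp /= expRD cosD sinD.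
by apply/eqP; rewrite eq_complex /=; apply/andP; split; apply/eqP; ring.
Qed.

Lemma cexp0 : cexp (0 : cplx R) = 1.
Proof.
by apply/eqP; rewrite /cexp eq_complex /= expR0 cos0 sin0 mulr1 mulr0 !eqxx.
Qed.

Lemma cexp_sum I (s : seq I) (P : pred I) (F : I -> cplx R) :
  cexp (\sum_(i <- s | P i) F i) = \prod_(i <- s | P i) cexp (F i).
Proof. exact: (big_morph _ cexpD cexp0). Qed.

Lemma cexpMn z n : cexp (z *+ n) = cexp z ^+ n.
Proof.
by elim: n => [|n IHn]; rewrite ?mulr0n ?cexp0// mulrS exprS cexpD IHn.
Qed.

Lemma cabs_cexp z : cabs (cexp z) = expR (complex.Re z).
Proof.
rewrite /cabs (normc_def (cexp z)) /= !exprMn -mulrDr cos2Dsin2 mulr1.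
by rewrite sqrtr_sqr ger0_norm// expR_ge0.
Qed.

Lemma cabs_cexp_le z : cabs (cexp z) <= expR (cabs z).
Proof. by rewrite cabs_cexp ler_expR (le_trans (ler_norm _))// Re_le_cabs. Qed.

End Modulus.

Section Exponential.
Variable R : realType.
Implicit Types (z w : cplx R) (x y : R).

Lemma is_derive_small_o (f : R -> R) (df e : R) : is_derive (0 : R) 1 f df ->
  0 < e -> \forall x \near 0, `|f x - f 0 - df * x| <= e * `|x|.
Proof.
move=> [fd fE] e0; have := fd; rewrite /derivable => /cvg_ex[l fl].
have {}fE : df = l by rewrite -fE /derive (cvg_lim _ fl).
rewrite -{}fE in fl; move/cvgrPdist_le/(_ e e0): fl.
rewrite near_withinE /=; apply: filterS => x /= xP.
have [->|x0] := eqVneq x 0; first by rewrite mulr0 subr0 subrr normr0 mulr0.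
move: (xP x0); rewrite /= addr0 [_ *: 1]mulr1 -[x^-1 *: _]/(x^-1 * _) => {}xP.
have -> : f x - f 0 - df * x = - ((df - x^-1 * (f x - f 0)) * x) by field.
by rewrite normrN normrM ler_wpM2r.
Qed.

Lemma cexp_small_o (e : R) : 0 < e ->
  exists2 r : R, 0 < r & forall z, cabs z <= r ->
    cabs (cexp z - 1 - z) <= e * cabs z.
Proof.
move=> e0; pose d := Num.min 1 (e / 6).
have d0 : 0 < d by rewrite lt_min ltr01 divr_gt0.
have d1 : d <= 1 by rewrite ge_min lexx.
have d6 : d * 6 <= e by rewrite -ler_pdivlMr// ge_min lexx orbT.
have E := is_derive_small_o (is_derive_expR (0 : R)) d0.
have S := is_derive_small_o (is_derive_sin (0 : R)) d0.
have C := is_derive_small_o (is_derive_cos (0 : R)) d0.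
have /nbhs_normP[r /= r0 rP] : \forall x \near 0,
    [/\ `|expR x - 1 - x| <= d * `|x|, `|sin x - x| <= d * `|x|
      & `|cos x - 1| <= d * `|x|].
  apply: filterS3 E S C => x.
  by rewrite expR0 sin0 cos0 !mul1r !oppr0 mul0r subr0 addr0; split.
pose r' := Num.min (d / 2) (r / 2).
have r'd : r' <= d / 2 by rewrite ge_min lexx.
have r'r : r' < r.
  by rewrite gt_min [X in _ || X]ltr_pdivrMr ?ltr_pMr ?ltr1n ?orbT.
exists r'; first by rewrite lt_min !divr_gt0.
move=> z zr; set x := complex.Re z; set y := complex.Im z.
have xz : `|x| <= cabs z := Re_le_cabs z.
have yz : `|y| <= cabs z := Im_le_cabs z.
have [Ex _ _] : [/\ `|expR x - 1 - x| <= d * `|x|, `|sin x - x| <= d * `|x|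
      & `|cos x - 1| <= d * `|x|].
  by apply: rP; rewrite /ball_ /= sub0r normrN (le_lt_trans xz)//
    (le_lt_trans zr).
have [_ Sy Cy] : [/\ `|expR y - 1 - y| <= d * `|y|, `|sin y - y| <= d * `|y|
      & `|cos y - 1| <= d * `|y|].
  by apply: rP; rewrite /ball_ /= sub0r normrN (le_lt_trans yz)//
    (le_lt_trans zr).
have z0 := cabs_ge0 z.
have Ex1 : `|expR x - 1| <= d.
  rewrite (_ : _ - 1 = (expR x - 1 - x) + x); last by rewrite subrK.
  rewrite (le_trans (ler_normD _ _))//.
  have : d * `|x| <= 1 * `|x| by rewrite ler_wpM2r.
  move: xz zr r'd Ex; lra.
have Ex2 : `|expR x| <= 2.
  rewrite (_ : expR x = (expR x - 1) + 1); last by rewrite subrK.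
  rewrite (le_trans (ler_normD _ _))// normr1; move: Ex1 d1; lra.
apply: (le_trans (cabs_le_ReIm _)).
have -> : complex.Re (cexp z - 1 - z) = (expR x - 1 - x) + expR x * (cos y - 1).
  by rewrite /x /y; case: (z) => a b /=; ring.
have -> : complex.Im (cexp z - 1 - z) = expR x * (sin y - y) + (expR x - 1) * y.
  by rewrite /x /y; case: (z) => a b /=; ring.
apply: (le_trans (lerD (ler_normD _ _) (ler_normD _ _))); rewrite !normrM.
have dxz : d * `|x| <= d * cabs z by rewrite ler_wpM2l// ltW.
have dyz : d * `|y| <= d * cabs z by rewrite ler_wpM2l// ltW.
have h1 : `|expR x| * `|cos y - 1| <= 2 * (d * cabs z).
  by rewrite ler_pM// (le_trans Cy).
have h2 : `|expR x| * `|sin y - y| <= 2 * (d * cabs z).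
  by rewrite ler_pM// (le_trans Sy).
have h3 : `|expR x - 1| * `|y| <= d * cabs z by rewrite ler_pM.
have h4 : d * 6 * cabs z <= e * cabs z by rewrite ler_wpM2r.
move: (le_trans Ex dxz) h1 h2 h3 h4; lra.
Qed.

Lemma cabs_subXn (u v : cplx R) (b : R) n : cabs u <= b -> cabs v <= b ->
  cabs (u ^+ n.+1 - v ^+ n.+1) <= cabs (u - v) * (b ^+ n *+ n.+1).
Proof.
move=> ub vb; rewrite subrXX cabsM ler_wpM2l ?cabs_ge0//.
rewrite (le_trans (cabs_sum _ _ _))// -[n.+1 in leRHS]card_ord -sumr_const.
apply: ler_sum => i _; rewrite cabsM !cabsX.
have -> : b ^+ n = b ^+ (n - i) * b ^+ i by rewrite -exprD subnK// -ltnS.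
by rewrite ler_pM ?exprn_ge0 ?cabs_ge0// lerXn2r// nnegrE
  ?cabs_ge0// (le_trans (cabs_ge0 u)).
Qed.

Lemma expR_divn x n : expR (x / n.+1%:R) ^+ n.+1 = expR x.
Proof. by rewrite -expRM_natl -mulr_natl mulrC divfK. Qed.

Definition cexp_approx n z : cplx R := (1 + n.+1%:R^-1 * z) ^+ n.+1.

Lemma cexp_approx_unif (r e : R) : 0 < e ->
  \forall n \near \oo, forall z, cabs z <= r ->
    cabs (cexp z - cexp_approx n z) <= e.
Proof.
move=> e0; have [r0|r0] := ltP r 0.
  by apply: nearW => n z /le_lt_trans/(_ r0); rewrite ltNge cabs_ge0.
pose d := e / (expR r * (r + 1)).
have d0 : 0 < d by rewrite divr_gt0// mulr_gt0 ?expR_gt0// ltr_wpDl.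
have [s s0 sP] := cexp_small_o d0.
near=> n.
move=> z zr.
have n0 : 0 < n.+1%:R :> R by rewrite ltr0n.
have nE : cabs (n.+1%:R^-1 * z) = cabs z / n.+1%:R.
  by rewrite cabsM cabsV -(rmorph_nat (@ofR R)) cabs_ofR normr_nat mulrC.
set w := n.+1%:R^-1 * z in nE *.
have zE : z = w *+ n.+1 by rewrite /w -mulr_natl mulrA divff ?mul1r// pnatr_eq0.
have wr : cabs w <= r / n.+1%:R by rewrite nE ler_pM2r ?invr_gt0.
have ws : cabs w <= s.
  apply: (le_trans wr); rewrite ler_pdivrMr// mulrC -ler_pdivrMr//.
  apply: (@le_trans _ _ n%:R); last by rewrite ler_nat.
  by near: n; exact: nbhs_infty_ger.
have ewb : cabs (cexp w) <= expR (r / n.+1%:R).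
  by rewrite (le_trans (cabs_cexp_le _))// ler_expR.
have wb : cabs (1 + w) <= expR (r / n.+1%:R).
  rewrite (le_trans (cabsD _ _))// cabs1 (le_trans (expR_ge1Dx _))//.
  by rewrite ler_expR.
rewrite [in cexp z]zE cexpMn (le_trans (cabs_subXn _ ewb wb))//.
have cw : cabs (cexp w - (1 + w)) <= d * (r / n.+1%:R).
  by rewrite opprD addrA (le_trans (sP _ ws))// ler_wpM2l// ltW.
have Er : expR (r / n.+1%:R) ^+ n <= expR r.
  by rewrite -(expR_divn r n) exprS ler_peMl ?exprn_ge0 ?expR_ge0// -expR0
    ler_expR divr_ge0.
have : cabs (cexp w - (1 + w)) * (expR (r / n.+1%:R) ^+ n *+ n.+1) <=
       d * (r / n.+1%:R) * (expR r *+ n.+1).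
  by rewrite ler_pM ?cabs_ge0 ?mulrn_wge0 ?exprn_ge0 ?expR_ge0//
    lerMn2r Er orbT.
move/le_trans; apply.
have -> : d * (r / n.+1%:R) * (expR r *+ n.+1) = e * (r / (r + 1)).
  rewrite /d -mulr_natr; field.
  by rewrite nat1r pnatr_eq0 !gt_eqF ?expR_gt0// ltr_wpDl.
by rewrite -[leRHS]mulr1 ler_pM2l// ler_pdivrMr ?mul1r ?ltr_wpDl// lerDl.
Unshelve. all: by end_near. Qed.

End Exponential.

Section RootsOfUnity.
Variable R : realType.

Lemma prim_root_exists n : (0 < n)%N -> exists w : cplx R, n.-primitive_root w.
Proof.
pose p : {poly cplx R} := 'X^n - 1; have [r Dp] := closed_field_poly_normal p.
move=> n_gt0; rewrite (monicP _) ?monicXnsubC // scale1r in Dp.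
have rn1: all n.-unity_root r by apply/allP=> z; rewrite -root_prod_XsubC -Dp.
have sz_r: (n < (size r).+1)%N.
  by rewrite -(size_prod_XsubC r id) -Dp size_XnsubC.
have [|z] := hasP (has_prim_root n_gt0 rn1 _ sz_r); last by exists z.
by rewrite -separable_prod_XsubC -Dp separable_Xn_sub_1 // pnatr_eq0 -lt0n.
Qed.

Lemma sum_prim_root_exp (F : fieldType) (n k : nat) (w : F) :
  n.-primitive_root w -> \sum_(i < n) w ^+ (k * i) = (n * (n %| k))%:R.
Proof.
move=> wn; have [nk|nk] := boolP (n %| k)%N.
  under eq_bigr => i _.
    have /eqP -> : w ^+ (k * i) == 1 by rewrite -(prim_order_dvd wn) dvdn_mulr.
    over.
  by rewrite sumr_const card_ord muln1.
have : (w ^+ k - 1) * \sum_(i < n) w ^+ (k * i) = 0.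
  under eq_bigr do rewrite exprM.
  by rewrite -subrX1 -exprM mulnC exprM (prim_expr_order wn) expr1n subrr.
move/eqP; rewrite mulf_eq0 subr_eq0 -(prim_order_dvd wn) (negbTE nk) /= muln0.
by move/eqP.
Qed.

Lemma coef_circle_le (p : {poly cplx R}) (r A : R) (m : nat) : 0 <= r ->
  (forall z, cabs z = r -> cabs p.[z] <= A) -> cabs p`_m * r ^+ m <= A.
Proof.
move=> r0 pA; pose n := (size p + m).+1.
have [w wn] := prim_root_exists (ltn0Sn (size p + m)).
have w1 : cabs w = 1.
  have : cabs w ^+ n = 1 by rewrite -cabsX (prim_expr_order wn) cabs1.
  by move/eqP; rewrite pexpr_eq1 ?cabs_ge0// => /eqP.
have mn : (m < n)%N by rewrite ltnS leq_addl.
have E : \sum_(k < n) p.[ofR r * w ^+ k] * w ^+ (k * (n - m)) =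
    n%:R * (p`_m * ofR r ^+ m).
  under eq_bigr => k _.
    rewrite (@horner_coef_wide _ n) ?ltnS ?leqW ?leq_addr// mulr_suml.
    under eq_bigr => i _.
      rewrite exprMn -!mulrA -exprM -exprD -mulnDr mulnC.
      over.
    over.
  rewrite exchange_big /= (bigD1 (Ordinal mn))//= [X in _ + X]big1 ?addr0.
    under eq_bigr do rewrite mulrA.
    rewrite -mulr_sumr subnKC ?(ltnW mn)// (sum_prim_root_exp _ wn) dvdnn muln1.
    by rewrite mulrC.
  move=> i im; under eq_bigr do rewrite mulrA.
  rewrite -mulr_sumr (sum_prim_root_exp _ wn).
  suff /negbTE -> : ~~ (n %| i + (n - m))%N by rewrite muln0 mulr0.
  apply: contra im; rewrite /dvdn -(mod0n n) -(eqn_modDr m) -addnA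
    subnK ?(ltnW mn)//.
  by rewrite modnDr add0n !modn_small.
have n0 : 0 < n%:R :> R by rewrite ltr0n.
rewrite -(ler_pM2l n0).
have -> : n%:R * (cabs p`_m * r ^+ m) = cabs (n%:R * (p`_m * ofR r ^+ m)).
  by rewrite !cabsM cabsX cabs_ofR (ger0_norm r0)
    -(rmorph_nat (@ofR R)) cabs_ofR normr_nat.
rewrite -E (le_trans (cabs_sum _ _ _))// mulr_natl -[n in leRHS]card_ord.
rewrite -sumr_const ler_sum// => k _.
rewrite cabsM cabsX w1 expr1n mulr1 pA// cabsM cabsX w1 expr1n mulr1.
by rewrite cabs_ofR ger0_norm.
Qed.

End RootsOfUnity.

Section Moments.
Variable R : realType.

Lemma ffact_ratio_cvg m :
  (fun n => (n.+1 ^_ m)%:R / n.+1%:R ^+ m : R) @ \oo --> (1 : R).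
Proof.
elim: m => [|m IHm].
  by under eq_fun do rewrite ffactn0 expr0 divr1; exact: cvg_cst.
have h : (fun n => 1 - m%:R * n.+1%:R^-1 : R) @ \oo --> (1 - m%:R * 0 : R).
  apply: cvgB; first exact: cvg_cst.
  by apply: cvgM; [exact: cvg_cst|exact: cvg_harmonic].
rewrite mulr0 subr0 in h; rewrite -[X in _ --> X]mulr1.
apply: cvg_trans (cvgM IHm h).
apply: near_eq_cvg; near=> n => /=.
have mn : (m <= n.+1)%N by near: n; exists m => // n /=; exact: leqW.
rewrite ffactnSr natrM natrB// exprSr; field.
by rewrite nat1r expf_neq0 pnatr_eq0.
Unshelve. all: by end_near. Qed.

Lemma coef_1DXn (a : cplx R) n m :
  ((1 + a *: 'X) ^+ n)`_m = a ^+ m *+ 'C(n, m).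
Proof.
rewrite exprDn coef_sum; have [mn|nm] := leqP m n; last first.
  rewrite bin_small// mulr0n big1// => -[i /= lei] _.
  rewrite expr1n mul1r exprZn coefMn coefZ coefXn.
  by rewrite gtn_eqF ?mulr0 ?mul0rn// (leq_ltn_trans _ nm).
rewrite (bigD1 (Ordinal (mn : (m < n.+1)%N)))//= big1 => [|i im].
  by rewrite expr1n mul1r exprZn coefMn coefZ coefXn eqxx mulr1 addr0.
rewrite expr1n mul1r exprZn coefMn coefZ coefXn.
by rewrite eq_sym -val_eqE /= in im *; rewrite (negbTE im) mulr0 mul0rn.
Qed.

Lemma fact_le_exp m : (m`! <= m ^ m)%N.
Proof.
rewrite fact_prod -{3}[m]card_ord -prod_nat_const big_add1 big_mkord.
by apply: leq_prod.
Qed.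

Variables (I : finType) (c w : I -> cplx R).

Lemma sum_cexp_coef_le (r A : R) m : 0 <= r ->
  (forall z, cabs z = r -> cabs (\sum_i c i * cexp (w i * z)) <= A) ->
  cabs (\sum_i c i * w i ^+ m) / m`!%:R * r ^+ m <= A.
Proof.
move=> r0 cA; apply/ler_addgt0Pr => e e0.
pose C := \sum_i cabs (c i); pose W := \sum_i cabs (w i).
have C0 : 0 <= C by rewrite sumr_ge0// => i _; exact: cabs_ge0.
have wW i : cabs (w i) <= W.
  by rewrite /W (bigD1 i)//= lerDl sumr_ge0// => j _; exact: cabs_ge0.
have d0 : 0 < e / (C + 1) by rewrite divr_gt0// ltr_wpDl.
pose mu := \sum_i c i * w i ^+ m.
have mulim : (fun n => cabs mu / m`!%:R * r ^+ m *
    ((n.+1 ^_ m)%:R / n.+1%:R ^+ m)) @ \oo --> cabs mu / m`!%:R * r ^+ m * 1.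
  by apply: cvgM; [exact: cvg_cst|exact: ffact_ratio_cvg].
rewrite -[leLHS]mulr1; apply: (cvgr_to_le mulim).
have := cexp_approx_unif (W * r) d0; apply: filterS => n nP.
pose p : {poly cplx R} :=
  \sum_i c i *: (1 + (n.+1%:R^-1 * w i) *: 'X) ^+ n.+1.
have pE z : p.[z] = \sum_i c i * cexp_approx n (w i * z).
  rewrite horner_sum; apply: eq_bigr => i _.
  by rewrite hornerZ horner_exp hornerD hornerZ hornerX -polyC1 hornerC
    /cexp_approx mulrA.
have pm : cabs p`_m * r ^+ m <= A + e.
  apply: coef_circle_le => // z zr.
  have -> : p.[z] = \sum_i c i * cexp (w i * z) -
      \sum_i c i * (cexp (w i * z) - cexp_approx n (w i * z)).
    by rewrite pE -sumrB; apply: eq_bigr => i _; ring.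
  rewrite (le_trans (cabsD _ _))// lerD ?cA// cabsN.
  rewrite (le_trans (cabs_sum _ _ _))//.
  apply: (@le_trans _ _ (\sum_i cabs (c i) * (e / (C + 1)))).
    apply: ler_sum => i _; rewrite cabsM ler_wpM2l ?cabs_ge0// nP// cabsM zr.
    by rewrite ler_wpM2r.
  rewrite -mulr_suml mulrCA -[leRHS]mulr1 ler_pM2l//.
  by rewrite ler_pdivrMr ?ltr_wpDl// mul1r lerDl.
suff <- : cabs p`_m * r ^+ m =
    cabs mu / m`!%:R * r ^+ m * ((n.+1 ^_ m)%:R / n.+1%:R ^+ m) by [].
have -> : p`_m = ofR ('C(n.+1, m)%:R / n.+1%:R ^+ m) * mu.
  rewrite coef_sum /mu mulr_sumr; apply: eq_bigr => i _.
  rewrite coefZ coef_1DXn exprMn exprVn -mulr_natr.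
  by rewrite rmorphM fmorphV rmorphXn !rmorph_nat; ring.
rewrite cabsM cabs_ofR ger0_norm ?divr_ge0 ?exprn_ge0// -bin_ffact natrM.
field.
by rewrite !expf_neq0 ?pnatr_eq0// -lt0n fact_gt0.
Qed.

Lemma sum_cexp_moment_le (e B : R) : 0 < B ->
  (forall z, cabs (\sum_i c i * cexp (w i * z)) <= e * expR (B * cabs z)) ->
  forall m, cabs (\sum_i c i * w i ^+ m) <= e * (expR 1 * B) ^+ m.
Proof.
move=> B0 cB m; set mu := cabs _.
have r0 : 0 <= m%:R / B by rewrite divr_ge0// ltW.
have BrE : B * (m%:R / B) = m%:R by rewrite mulrC divfK// gt_eqF.
have mur : mu / m`!%:R * (m%:R / B) ^+ m <= e * expR m%:R.
  by apply: sum_cexp_coef_le => // z zr; rewrite (le_trans (cB z))// zr BrE.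
have mm0 : 0 < m%:R ^+ m :> R.
  by case: m {mu r0 BrE mur} => // m; rewrite exprn_gt0.
have fm0 : 0 < m`!%:R :> R by rewrite ltr0n fact_gt0.
have Bm0 : 0 < B ^+ m by rewrite exprn_gt0.
have -> : e * (expR 1 * B) ^+ m = e * expR m%:R * B ^+ m.
  by rewrite exprMn -expRM_natl mulr1 mulrA.
rewrite -ler_pdivrMr//; apply: le_trans mur.
have -> : mu / m`!%:R * (m%:R / B) ^+ m = mu / B ^+ m * (m%:R ^+ m / m`!%:R).
  by rewrite expr_div_n; ring.
rewrite ler_peMr ?divr_ge0 ?cabs_ge0 ?(ltW Bm0)// ler_pdivlMr//.
by rewrite mul1r -natrX ler_nat fact_le_exp.
Qed.

End Moments.

Section Domination.
Variable R : realType.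
Implicit Types (p q : {poly cplx R}) (P Q : {poly R}).

Definition dominated p P := forall k, cabs p`_k <= P`_k.

Lemma dominated_ge0 p P k : dominated p P -> 0 <= P`_k.
Proof. by move=> pP; exact: le_trans (cabs_ge0 _) (pP k). Qed.

Lemma dominatedC z : dominated z%:P (cabs z)%:P.
Proof. by move=> k; rewrite !coefC; case: ifP => // _; rewrite cabs0. Qed.

Lemma dominated1 : dominated 1 1.
Proof. by have := dominatedC 1; rewrite cabs1. Qed.

Lemma dominatedXn n : dominated 'X^n 'X^n.
Proof. by move=> k; rewrite !coefXn; case: eqP; rewrite /= ?cabs1 ?cabs0. Qed.

Lemma dominatedD p q P Q :
  dominated p P -> dominated q Q -> dominated (p + q) (P + Q).
Proof.
by move=> pP qQ k; rewrite !coefD (le_trans (cabsD _ _))// lerD.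
Qed.

Lemma dominated_sum I (s : seq I) (p : I -> {poly cplx R}) (P : I -> {poly R}) :
  (forall i, dominated (p i) (P i)) ->
  dominated (\sum_(i <- s) p i) (\sum_(i <- s) P i).
Proof.
move=> pP; apply: (big_ind2 dominated) => //.
  by move=> k; rewrite !coef0 cabs0.
by move=> *; exact: dominatedD.
Qed.

Lemma dominatedM p q P Q :
  dominated p P -> dominated q Q -> dominated (p * q) (P * Q).
Proof.
move=> pP qQ k; rewrite !coefM (le_trans (cabs_sum _ _ _))//.
by apply: ler_sum => i _; rewrite cabsM ler_pM ?cabs_ge0.
Qed.

Lemma dominated_exp p P n : dominated p P -> dominated (p ^+ n) (P ^+ n).
Proof.
move=> pP; elim: n => [|n IHn]; first exact: dominated1.
by rewrite !exprS; exact: dominatedM.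
Qed.

Lemma dominatedZ z p P : dominated p P -> dominated (z *: p) (cabs z *: P).
Proof. by move=> pP k; rewrite !coefZ cabsM ler_wpM2l ?cabs_ge0. Qed.

Lemma dominated_map_cabs p : dominated p (map_poly (@cabs R) p).
Proof. by move=> k; rewrite coef_map_id0 ?cabs0. Qed.

Variables (I : finType) (c w : I -> cplx R) (e r : R).
Hypotheses (r0 : 0 <= r)
  (mom : forall m, cabs (\sum_i c i * w i ^+ m) <= e * r ^+ m).

Let e0 : 0 <= e.
Proof. by have := mom 0; rewrite mulr1; exact/le_trans/cabs_ge0. Qed.

Lemma dominated_sum_le p P : dominated p P ->
  cabs (\sum_i c i * p.[w i]) <= e * P.[r].
Proof.
move=> pP; pose n := maxn (size p) (size P).
rewrite (@horner_coef_wide _ n P) ?leq_maxr//.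
under eq_bigr do rewrite (@horner_coef_wide _ n p) ?leq_maxl// mulr_sumr.
rewrite exchange_big /= mulr_sumr (le_trans (cabs_sum _ _ _))//.
apply: ler_sum => k _; under eq_bigr do rewrite mulrCA.
by rewrite -mulr_sumr cabsM mulrCA ler_pM ?cabs_ge0.
Qed.

(* Testing the moments against X^m times the polynomial vanishing at all the
   other frequencies isolates the weight at v, which is O((r / |v|)^m). *)
Lemma fiber_sum_eq0 v : r < cabs v -> \sum_(i | w i == v) c i = 0.
Proof.
move=> rv; pose p : {poly cplx R} := \prod_(i | w i != v) ('X - (w i)%:P).
have v0 : 0 < cabs v by exact: le_lt_trans rv.
have pv : p.[v] != 0.
  rewrite horner_prod; apply/prodf_neq0 => i wv.
  by rewrite hornerXsubC subr_eq0 eq_sym.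
set S := \sum_(_ | _) _; pose C := e * (map_poly (@cabs R) p).[r].
have key m : cabs (S * p.[v]) <= C * (r / cabs v) ^+ m.
  have := dominated_sum_le (dominatedM (dominatedXn m) (dominated_map_cabs p)).
  rewrite (bigID (fun i => w i == v))/= [X in _ + X]big1 ?addr0; last first.
    move=> i wv; rewrite hornerM [p.[_]]horner_prod (bigD1 i)//= hornerXsubC.
    by rewrite subrr mul0r !mulr0.
  under eq_bigr => i /eqP -> do [].
  rewrite -mulr_suml !hornerM !hornerXn -/S => h.
  rewrite expr_div_n mulrA ler_pdivlMr ?exprn_gt0// -cabsX -cabsM.
  by rewrite -mulrA [p.[v] * _]mulrC (le_trans h)// mulrCA mulrC.
have lim0 : (fun m => C * (r / cabs v) ^+ m) @ \oo --> C * 0.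
  apply: cvgM; first exact: cvg_cst.
  apply: cvg_expr; rewrite ger0_norm ?divr_ge0 ?cabs_ge0//.
  by rewrite ltr_pdivrMr// mul1r.
have : cabs (S * p.[v]) <= C * 0.
  by apply: (cvgr_to_ge lim0); exact: nearW.
rewrite mulr0 => h; have : cabs (S * p.[v]) == 0 by rewrite eq_le h cabs_ge0.
by rewrite cabs_eq0 mulf_eq0 (negbTE pv) orbF => /eqP.
Qed.

Lemma sum_restrict_disc (F : cplx R -> cplx R) :
  \sum_i c i * F (w i) = \sum_(i | cabs (w i) <= r) c i * F (w i).
Proof.
rewrite (bigID (fun i => cabs (w i) <= r))/= [X in _ + X](_ : _ = 0) ?addr0//.
pose s := undup [seq w i | i : I].
have sE i : c i * F (w i) = \sum_(v <- s) (if w i == v then c i * F v else 0).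
  have ws : w i \in s by rewrite mem_undup map_f ?mem_enum.
  rewrite (bigD1_seq (w i)) ?undup_uniq//= ?eqxx.
  by rewrite big1 ?addr0// => v; rewrite eq_sym => /negbTE ->.
under eq_bigr do rewrite sE.
rewrite exchange_big big1_seq//= => v _; rewrite -big_mkcondr /=.
have [vr|rv] := leP (cabs v) r.
  by rewrite big1// => i /andP[+ /eqP wv]; rewrite wv vr.
rewrite -mulr_suml (eq_bigl (fun i => w i == v)) ?fiber_sum_eq0 ?mul0r// => i.
by rewrite -ltNge; case: eqP => [->|]; rewrite ?rv ?andbF.
Qed.

Lemma dominated_cexp_sum_le p P : dominated p P ->
  cabs (\sum_i c i * cexp p.[w i]) <= e * expR P.[r].
Proof.
move=> pP; apply/ler_addgt0Pr => d d0.
pose C := \sum_i cabs (c i); pose W := \sum_i cabs p.[w i].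
have C0 : 0 <= C by rewrite sumr_ge0// => i _; exact: cabs_ge0.
have wW i : cabs p.[w i] <= W.
  by rewrite /W (bigD1 i)//= lerDl sumr_ge0// => j _; exact: cabs_ge0.
have dC : 0 < d / (C + 1) by rewrite divr_gt0// ltr_wpDl.
have [n _ /(_ n (leqnn n)) nP] := cexp_approx_unif W dC.
pose q := (1 + n.+1%:R^-1 *: p) ^+ n.+1.
pose Q := (1 + n.+1%:R^-1 *: P) ^+ n.+1.
have qQ : dominated q Q.
  apply: dominated_exp; apply: dominatedD; first exact: dominated1.
  have -> : n.+1%:R^-1 = cabs (n.+1%:R^-1) :> R.
    by rewrite cabsV -(rmorph_nat (@ofR R)) cabs_ofR normr_nat.
  exact: dominatedZ.
have -> : \sum_i c i * cexp p.[w i] = \sum_i c i * q.[w i] +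
    \sum_i c i * (cexp p.[w i] - cexp_approx n p.[w i]).
  rewrite -big_split; apply: eq_bigr => i _ /=.
  rewrite /q horner_exp hornerD hornerZ -polyC1 hornerC /cexp_approx; ring.
rewrite (le_trans (cabsD _ _))// lerD//.
  rewrite (le_trans (dominated_sum_le qQ))// ler_wpM2l//.
  rewrite /Q horner_exp hornerD hornerZ -polyC1 hornerC mulrC.
  have P0 : 0 <= P.[r].
    rewrite horner_coef sumr_ge0// => k _.
    by rewrite mulr_ge0 ?exprn_ge0 ?(dominated_ge0 _ pP).
  rewrite -(expR_divn P.[r] n) lerXn2r ?nnegrE ?expR_ge0 ?expR_ge1Dx//.
  by rewrite addr_ge0// divr_ge0.
rewrite (le_trans (cabs_sum _ _ _))//.
apply: (@le_trans _ _ (\sum_i cabs (c i) * (d / (C + 1)))).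
  by apply: ler_sum => i _; rewrite cabsM ler_wpM2l ?cabs_ge0// nP.
rewrite -mulr_suml mulrCA -[leRHS]mulr1 ler_pM2l//.
by rewrite ler_pdivrMr ?ltr_wpDl// mul1r lerDl.
Qed.

End Domination.

Section Convergence.
Variable R : realType.

Lemma cvg_cabs_le (u : nat -> cplx R) (l : cplx R) : u @ \oo --> l ->
  forall e : R, 0 < e -> \forall n \near \oo, cabs (u n - l) <= e.
Proof.
move=> /cvgrPdist_le ul e e0.
have e0' : 0 < ofR e by rewrite -(rmorph0 (@ofR R)) /Order.lt /= eqxx.
apply: filterS (ul _ e0') => n; rewrite cabsB.
by rewrite -ler_ofR -cabs_norm.
Qed.

Lemma cvg_sumr (I : Type) (s : seq I) (u : I -> nat -> cplx R)
    (l : I -> cplx R) :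
  (forall i, u i @ \oo --> l i) ->
  (fun k => \sum_(i <- s) u i k) @ \oo --> \sum_(i <- s) l i.
Proof.
move=> ul; apply: (@cvg_big (cplx R) I +%R 0 xpredT _ _ \oo s u l) => //.
exact: add_continuous.
Qed.

Lemma uniform_cvg_cabs (T : choiceType) (K : set T) (F : nat -> T -> cplx R)
    (f : T -> cplx R) :
  (forall e : R, 0 < e ->
    \forall n \near \oo, forall x, K x -> cabs (F n x - f x) <= e) ->
  {uniform K, F @ \oo --> f}.
Proof.
move=> Ff W /uniform_nbhs[E [entE EW]].
move: entE; rewrite -entourage_ballE => -[e /= e0 eE].
have e0' : 0 < complex.Re e / 2.
  by move: e0; rewrite ltcE => /andP[_ /= ?]; rewrite divr_gt0.
have eR : e = ofR (complex.Re e).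
  by rewrite -[LHS]RRe_real// gtr0_real.
apply: filterS (Ff _ e0') => n nP; apply: EW => /= x Kx; apply: eE => /=.
rewrite -ball_normE /= distrC eR cabs_norm.
rewrite ltcR (le_lt_trans (nP x Kx))// ltr_pdivrMr// ltr_pMr ?ltr1n//.
by move: e0'; rewrite pmulr_lgt0.
Qed.

Lemma cexp_cvg (u : nat -> cplx R) (l : cplx R) : u @ \oo --> l ->
  forall e : R, 0 < e -> \forall n \near \oo, cabs (cexp (u n) - cexp l) <= e.
Proof.
move=> ul e e0; have [r r0 rP] := cexp_small_o (@ltr01 R).
have L0 : 0 < cabs (cexp l) by rewrite cabs_cexp expR_gt0.
have d0 : 0 < e / (cabs (cexp l) * 2) by rewrite divr_gt0// mulr_gt0.
near=> n.
have h1 : cabs (u n - l) <= r by near: n; exact: cvg_cabs_le.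
have h2 : cabs (u n - l) <= e / (cabs (cexp l) * 2).
  by near: n; exact: cvg_cabs_le.
have -> : cexp (u n) - cexp l = cexp l * (cexp (u n - l) - 1).
  by rewrite mulrBr mulr1 -cexpD subrKC.
rewrite cabsM -ler_pdivlMl//.
have -> : cexp (u n - l) - 1 = (cexp (u n - l) - 1 - (u n - l)) + (u n - l).
  by rewrite subrK.
rewrite (le_trans (cabsD _ _))//; have := rP _ h1; rewrite mul1r => h3.
have -> : (cabs (cexp l))^-1 * e =
    e / (cabs (cexp l) * 2) + e / (cabs (cexp l) * 2).
  by field; rewrite gt_eqF.
by rewrite lerD// (le_trans h3).
Unshelve. all: by end_near. Qed.

Lemma dominated_limit_cexp_sum_le (I : finType) (c w : I -> cplx R) (e r A : R)
    (p : nat -> {poly cplx R}) (P : nat -> {poly R}) (s : cplx R -> cplx R) :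
  0 <= r -> (forall m, cabs (\sum_i c i * w i ^+ m) <= e * r ^+ m) ->
  (forall k, dominated (p k) (P k)) -> (forall k, (P k).[r] <= A) ->
  (forall i, cabs (w i) <= r -> (fun k => (p k).[w i]) @ \oo --> s (w i)) ->
  cabs (\sum_i c i * cexp (s (w i))) <= e * expR A.
Proof.
move=> r0 mom pP PA ps; apply/ler_addgt0Pr => d d0.
have e0 : 0 <= e by have := mom 0; rewrite mulr1; exact/le_trans/cabs_ge0.
pose C := \sum_(i | cabs (w i) <= r) cabs (c i).
have C0 : 0 <= C by rewrite sumr_ge0// => i _; exact: cabs_ge0.
have dC : 0 < d / (C + 1) by rewrite divr_gt0// ltr_wpDl.
have [k _ /(_ k (leqnn k)) kP] :
    \forall k \near \oo, forall i, cabs (w i) <= r ->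
    cabs (cexp (p k).[w i] - cexp (s (w i))) <= d / (C + 1).
  apply: filter_forall => i; have [wr|rw] := leP (cabs (w i)) r.
    by apply: filterS (cexp_cvg (ps i wr) dC) => k h _.
  exact: nearW.
have := dominated_cexp_sum_le r0 mom (pP k).
rewrite (sum_restrict_disc r0 mom (fun z => cexp (s z))).
rewrite (sum_restrict_disc r0 mom (fun z => cexp (p k).[z])) => h.
rewrite [X in cabs X](_ : _ =
    \sum_(i | cabs (w i) <= r) c i * cexp (p k).[w i] -
    \sum_(i | cabs (w i) <= r) c i * (cexp (p k).[w i] - cexp (s (w i))));
    last first.
  by rewrite -sumrB; apply: eq_bigr => i _; ring.
rewrite (le_trans (cabsD _ _))// cabsN lerD//.
  by rewrite (le_trans h)// ler_wpM2l// ler_expR.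
rewrite (le_trans (cabs_sum _ _ _))//.
apply: (@le_trans _ _ (\sum_(i | cabs (w i) <= r) cabs (c i) * (d / (C + 1)))).
  by apply: ler_sum => i wr; rewrite cabsM ler_wpM2l ?cabs_ge0// kP.
rewrite -mulr_suml mulrCA -[leRHS]mulr1 ler_pM2l//.
by rewrite ler_pdivrMr ?ltr_wpDl// mul1r lerDl.
Qed.

Lemma cvg_power_series_abs_bound (g : nat -> cplx R) (r rho : R) :
  0 <= r -> r < rho -> cvgn (series (fun m => g m * ofR rho ^+ m)) ->
  exists2 C : R, 0 <= C & forall k, \sum_(m < k) cabs (g m) * r ^+ m <= C.
Proof.
move=> r0 rrho /cvg_series_cvg_0 /cvg_cabs_le/(_ _ ltr01)[N _ NP].
have rho0 : 0 < rho by exact: le_lt_trans rrho.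
pose M := 1 + \sum_(m < N) cabs (g m) * rho ^+ m.
have gE m : cabs (g m * ofR rho ^+ m) = cabs (g m) * rho ^+ m.
  by rewrite cabsM cabsX cabs_ofR gtr0_norm.
have t0 m : 0 <= cabs (g m) * rho ^+ m.
  by rewrite mulr_ge0 ?cabs_ge0 ?exprn_ge0 ?ltW.
have M0 : 0 <= M by rewrite addr_ge0// sumr_ge0.
have gM m : cabs (g m) * rho ^+ m <= M.
  have [Nm|mN] := leqP N m.
    have := NP m Nm; rewrite subr0 gE => /le_trans; apply.
    by rewrite lerDl sumr_ge0.
  by rewrite /M (bigD1 (Ordinal mN))//= addrCA lerDl addr_ge0// sumr_ge0.
pose t := r / rho.
have t_ge0 : 0 <= t by rewrite divr_ge0// ltW.
have t1 : 0 < 1 - t by rewrite subr_gt0 ltr_pdivrMr// mul1r.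
exists (M / (1 - t)) => [|k]; first by rewrite divr_ge0// ltW.
rewrite ler_pdivlMr//.
have : \sum_(m < k) cabs (g m) * r ^+ m <= M * \sum_(m < k) t ^+ m.
  rewrite mulr_sumr; apply: ler_sum => m _.
  have -> : cabs (g m) * r ^+ m = cabs (g m) * rho ^+ m * t ^+ m.
    by rewrite -mulrA -exprMn [rho * _]mulrC divfK// gt_eqF.
  by rewrite ler_wpM2r// exprn_ge0.
move/(ler_wpM2r (ltW t1))/le_trans; apply.
have -> : M * (\sum_(m < k) t ^+ m) * (1 - t) = M * (1 - t ^+ k).
  rewrite -mulrA; congr (_ * _).
  by rewrite mulrC -[LHS]opprK -mulNr opprB -subrX1 opprB.
by rewrite ler_piMr// gerBl exprn_ge0.
Qed.

End Convergence.

Lemma normA1_lt_le (R : realType) (B e : R) (f : cplx R -> cplx R) :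
  (normA1 B f < e%:E)%E -> forall z, cabs (f z) <= e * expR (B * cabs z).
Proof.
move=> fe z; rewrite -ler_pdivrMr ?expR_gt0// -expRN -lee_fin.
by apply: le_trans (ltW fe); apply: ereal_sup_ubound; exists z.
Qed.

Lemma ereal_lt_between (R : realType) (r : R) (x : \bar R) : (r%:E < x)%E ->
  exists2 s : R, r < s & (s%:E < x)%E.
Proof.
case: x => [x|_|//]; last by exists (r + 1); rewrite ?ltrDl ?ltry.
by rewrite lte_fin => rx; exists ((r + x) / 2); rewrite ?lte_fin midf_lt.
Qed.

Lemma compact_coord_bound (R : realType) (d : nat) (K : set 'rV[R]_d) :
  compact K -> exists2 M : R, 0 <= M & forall x l, K x -> `|x ord0 l| <= M.
Proof.
move=> /compact_bounded[M0 [_ KM]].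
have {KM}KM := KM _ (ltr_pwDr ltr01 (ler_norm M0)).
exists (`|M0| + 1) => [|x l /KM]; first by rewrite addr_ge0.
apply: le_trans; rewrite [leRHS]/Num.norm /= mx_normrE.
by apply: (le_bigmax _ (fun i => `|x i.1 i.2|) (ord0, l)).
Qed.

Lemma gfs1_moment_le (R : realType) (Z : nat -> nat -> R -> cplx R)
    (h : nat -> nat -> R) (a B e : R) (n : nat) : 0 < B ->
  (normA1 B (fun z => (gfs1 Z h a n z - cexp ('i * ofR a * z))%R) < e%:E)%E ->
  let c (i : 'I_n.+2) : cplx R := if (i < n.+1)%N then Z n i a else - 1 in
  let w (i : 'I_n.+2) : cplx R := ofR (if (i < n.+1)%N then h n i else a) in
  forall m, cabs (\sum_i c i * w i ^+ m) <= e * (expR 1 * B) ^+ m.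
Proof.
move=> B0 /normA1_lt_le D c w; apply: sum_cexp_moment_le => // z.
have := D (- 'i * z); rewrite cabsM cabsN cabsi mul1r; apply: le_trans.
have iz (x : R) : 'i * ofR x * (- 'i * z) = ofR x * z.
  have -> : 'i * ofR x * (- 'i * z) = - ('i ^+ 2) * (ofR x * z) by ring.
  by rewrite sqrCi opprK mul1r.
rewrite big_ord_recr /= /c /w /= ltnn iz mulN1r /gfs1.
suff -> : \sum_(j < n.+1) Z n j a * cexp ('i * ofR (h n j) * (- 'i * z)) =
  \sum_(i < n.+1) (if (i < n.+1)%N then Z n i a else -1) *
    cexp (ofR (if (i < n.+1)%N then h n i else a) * z) by [].
by apply: eq_bigr => i _; rewrite ltn_ord iz.
Qed.

Theorem theorem3p3 (R : realType) (d : nat) (hd : (0 < d)%N)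
    (rad : 'I_d -> \bar R) (hrad : forall l, (1 <= rad l)%E)
    (G : 'I_d -> cplx R -> cplx R) (g : 'I_d -> nat -> cplx R)
    (hlimsup : forall l,
       limn_esup (fun m : nat => (cabs (g l m) `^ (m%:R^-1))%:E)
       = ((rad l)^-1)%E)
    (hGhol : forall l z, ((cabs z)%:E < rad l)%E -> holomorphic_at (G l) z)
    (hGser : forall l z, ((cabs z)%:E < rad l)%E ->
       series (fun m : nat => g l m * z ^+ m) @ \oo --> G l z)
    (Z : nat -> nat -> R -> cplx R) (h : nat -> nat -> R) (a : R)
    (hsuper : superoscillating1 Z h a)
    (B : R) (hB0 : 0 < B)
    (hBR : (B%:E < (\big[mine/+oo]_(l < d) rad l) / (4 * expR 1)%:E)%E)
    (hcvg : cvgA1 B (gfs1 Z h a) (fun xi => cexp ('i * ofR a * xi)))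
    (haR : (`|a|%:E < \big[mine/+oo]_(l < d) rad l)%E) :
  (forall K : set 'rV[R]_d, compact K ->
     {uniform K,
       (fun (n : nat) (x : 'rV[R]_d) =>
          \sum_(j < n.+1) Z n j a *
            \prod_(l < d) cexp ('i * ofR (x ord0 l) * G l (ofR (h n j))))
       @ \oo -->
       (fun x : 'rV[R]_d =>
          \prod_(l < d) cexp ('i * ofR (x ord0 l) * G l (ofR a)))}) /\
  (1 < `|a| ->
   forall (k : nat -> nat -> 'I_d -> R) (gam : 'I_d -> R),
     (forall n j l, (j <= n)%N ->
        G l (ofR (h n j)) = ofR (k n j l) /\ `|k n j l| <= 1) ->
     (forall l, G l (ofR a) = ofR (gam l) /\ 1 < `|gam l|) ->
     superoscillating (fun n j => Z n j a) k /\
     forall K : set 'rV[R]_d, compact K ->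
       superoscillation_set (fun n j => Z n j a) k gam K).
Proof.
pose F (n : nat) (x : 'rV[R]_d) := \sum_(j < n.+1) Z n j a *
  \prod_(l < d) cexp ('i * ofR (x ord0 l) * G l (ofR (h n j))).
pose F0 (x : 'rV[R]_d) :=
  \prod_(l < d) cexp ('i * ofR (x ord0 l) * G l (ofR a)).
have main (K : set 'rV[R]_d) : compact K -> {uniform K, F @ \oo --> F0}.
  move=> /compact_coord_bound[M M0 KM].
  pose r := expR 1 * B; have r0 : 0 < r by rewrite mulr_gt0 ?expR_gt0.
  have r_rad l : (r%:E < rad l)%E.
    have e40 : 0 < 4 * expR 1 :> R by rewrite mulr_gt0 ?expR_gt0.
    move: hBR; rewrite inver gt_eqF// lte_pdivlMr// -EFinM => rR.
    apply: lt_le_trans (bigmin_le +oo%E l rad); apply: le_lt_trans rR.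
    by rewrite lee_fin mulrCA [B * _]mulrC ler_peMl ?ler1n ?(ltW r0).
  have /choice[C CP] l : exists C : R, 0 <= C /\
      forall k, \sum_(m < k) cabs (g l m) * r ^+ m <= C.
    have [s rs srad] := ereal_lt_between (r_rad l).
    have s0 : 0 < s := lt_trans r0 rs.
    have [|C C0 gC] := cvg_power_series_abs_bound (ltW r0) rs (g := g l).
      apply/cvg_ex; exists (G l (ofR s)); apply: hGser.
      by rewrite cabs_ofR gtr0_norm.
    by exists C.
  pose A := \sum_(l < d) M * C l.
  apply: uniform_cvg_cabs => e e0.
  pose e' := e / expR A; have e'0 : 0 < e' by rewrite divr_gt0 ?expR_gt0.
  case: hcvg => _ _ /(_ [set x | (x < e'%:E)%E])/=[|N _ NP].
    exists e' => //= x; rewrite /ball_ /= sub0r normrN lte_fin.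
    by apply: le_lt_trans; exact: ler_norm.
  exists N => // n /NP /= /(gfs1_moment_le hB0) mom x Kx.
  pose p k : {poly cplx R} := \sum_(l < d) ('i * ofR (x ord0 l)) *:
    \sum_(m < k) g l m *: 'X^m.
  pose P k : {poly R} := \sum_(l < d) cabs ('i * ofR (x ord0 l)) *:
    \sum_(m < k) cabs (g l m) *: 'X^m.
  pose s z := \sum_(l < d) 'i * ofR (x ord0 l) * G l z.
  have := dominated_limit_cexp_sum_le (p := p) (P := P) (s := s) (A := A)
    (ltW r0) mom.
  have -> : e' * expR A = e by rewrite divfK// gt_eqF ?expR_gt0.
  rewrite big_ord_recr /= ltnn mulN1r.
  have -> : cexp (s (ofR a)) = F0 x by rewrite cexp_sum.
  have -> : F n x = \sum_(i < n.+1) (if (i < n.+1)%N then Z n i a else -1) *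
      cexp (s (ofR (if (i < n.+1)%N then h n i else a))).
    by apply: eq_bigr => i _; rewrite ltn_ord cexp_sum.
  apply.
  - move=> k; apply: dominated_sum => l; apply: dominatedZ.
    by apply: dominated_sum => m; apply: dominatedZ; exact: dominatedXn.
  - move=> k; rewrite horner_sum; apply: ler_sum => l _.
    rewrite hornerZ cabsM cabsi mul1r cabs_ofR ler_pM ?KM//.
      rewrite horner_sum sumr_ge0// => m _.
      by rewrite hornerZ hornerXn mulr_ge0 ?cabs_ge0// exprn_ge0// ltW.
    rewrite horner_sum; have [_ /(_ k)] := CP l; apply: le_trans.
    by apply: ler_sum => m _; rewrite hornerZ hornerXn.
  - move=> i wr; set z := ofR _ in wr *.
    have -> : (fun k => (p k).[z]) =
        (fun k => \sum_(l < d) 'i * ofR (x ord0 l) *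
          series (fun m => g l m * z ^+ m) k).
      apply/funext => k; rewrite horner_sum; apply: eq_bigr => l _.
      rewrite hornerZ horner_sum /series /= big_mkord; congr (_ * _).
      by apply: eq_bigr => m _; rewrite hornerZ hornerXn.
    apply: cvg_sumr => l.
    apply: cvgM; first exact: cvg_cst.
    by apply: hGser; apply: le_lt_trans (r_rad l); rewrite lee_fin.
split=> // a1 k gam kP gamP.
have gfsE : gfs (fun n j => Z n j a) k = F.
  apply/funext => n; apply/funext => x; apply: eq_bigr => j _; congr (_ * _).
  apply: eq_bigr => l _; have [-> _] := kP n j l (ltn_ord j).
  by rewrite rmorphM mulrA.
have F0E : (fun x : 'rV[R]_d =>
    \prod_(l < d) cexp ('i * ofR (x ord0 l * gam l))) = F0.
  apply/funext => x; apply: eq_bigr => l _; have [-> _] := gamP l.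
  by rewrite rmorphM mulrA.
have sK (K : set 'rV[R]_d) : compact K ->
    superoscillation_set (fun n j => Z n j a) k gam K.
  move=> cK; split=> // [l|]; first by have [] := gamP l.
  by rewrite gfsE F0E; exact: main.
split=> //; split=> [n j l jn|]; first by have [] := kP n j l jn.
by exists gam, set0; apply: sK; exact: compact0.
Qed.
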